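(* For integers $n \ge 0$ and $i \in \{0,1,2,3\}$, let $a_i(n)$ denote the number of partitions $\lambda$ of $n$ whose dimension $f^\lambda$ satisfies $f^\lambda \equiv i \pmod 4$, and let $a(n) = a_1(n) + a_3(n)$ be the number of partitions of $n$ with odd dimension (with $a(0)=1$, $a_2(0)=0$, the empty partition having dimension $1$). Let $n = 2^R + m$ with integers $R \ge 1$ and $0 \le m < 2^R$. Then \[a_2(n) = \begin{cases} 2^R\cdot a_2(m) + \binom{2^{R-1}}{2}\cdot a(m), & \text{ if }m < 2^{R-1},\\[4pt] 2^R\cdot a_2(m) + \left(\binom{2^{R-1}}{3} + 2^{R-1}\right) \cdot \dfrac{a(m)}{2^{R-1}}, & \text{ if } 2^{R-1} \leq m < 2^R. \end{cases}\]
   Context: A partition of $n$ is a weakly decreasing sequence of positive integers summing to $n$. The dimension $f^\lambda$ of a partition $\lambda$ is the number of standard Young tableaux of shape $\lambda$, i.e. fillings of the Ferrers diagram of $\lambda$ with $1,\dots,n$, each used once, increasing strictly along rows and down columns. *)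

(* Defs.v *)
From mathcomp Require Import all_boot.

Set Implicit Arguments.
Unset Strict Implicit.
Unset Printing Implicit Defensive.

Definition is_partition (n : nat) (la : seq nat) : bool :=
  [&& sorted geq la, all (leq 1) la & sumn la == n].

(* A partition of n has at most n parts, each at most n, so nothing is lost by
   this finite carrier: see [partitionsP]. *)
Definition partitions (n : nat) : {set {bseq n of 'I_n.+1}} :=
  [set la : {bseq n of 'I_n.+1} | is_partition n (map val la)].

Definition box (la : seq nat) : finType :=
  {r : 'I_(size la) & 'I_(nth 0 la r)}.

Definition box_row (la : seq nat) (b : box la) : nat := tag b.
Definition box_col (la : seq nat) (b : box la) : nat := tagged b.

(* The entry k : 'I_n stands for the integer k + 1 of {1, ..., n}. *)
Definition is_standard (la : seq nat) (t : {ffun box la -> 'I_(sumn la)}) :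
    bool :=
  [&& [forall k, #|[set b | t b == k]| == 1],
      [forall b, forall b', (box_row b == box_row b') && (box_col b < box_col b')
                              ==> (t b < t b')]
    & [forall b, forall b', (box_col b == box_col b') && (box_row b < box_row b')
                              ==> (t b < t b')]].

Definition dimension (la : seq nat) : nat :=
  #|[set t : {ffun box la -> 'I_(sumn la)} | is_standard t]|.

Definition a_mod4 (i n : nat) : nat :=
  #|[set la : {bseq n of 'I_n.+1} in partitions n |
      dimension (map val la) == i %[mod 4]]|.

Definition a_odd (n : nat) : nat := a_mod4 1 n + a_mod4 3 n.

Lemma partitionsP (n : nat) (la : seq nat) :
  reflect (exists2 p, p \in partitions n & la = map val p)
          (is_partition n la).
Proof.
apply: (iffP idP) => [Hla | [p + ->]]; last by rewrite inE.
have /and3P[_ Hpos /eqP Hsum] := Hla.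
have Hsz : size la <= n.
  rewrite -Hsum; elim: la Hpos {Hla Hsum} => //= x s IH /andP[Hx Hs].
  by rewrite -add1n leq_add // IH.
have Hle : all (ltn^~ n.+1) la.
  apply/allP => x Hx; rewrite /= ltnS -Hsum.
  elim: la Hx {Hla Hpos Hsum Hsz} => //= y s IH; rewrite inE.
  by case/predU1P => [-> | /IH Hx]; rewrite ?leq_addr // (leq_trans Hx) ?leq_addl.
have Hval : map val (map (@inord n) la) = la.
  rewrite -map_comp -[RHS]map_id; apply/eq_in_map => x /(allP Hle) Hx /=.
  by rewrite inordK.
have Hsz' : size (map (@inord n) la) <= n by rewrite size_map.
by exists (Bseq Hsz'); rewrite ?inE /= Hval.
Qed.

Lemma dimension_nil : dimension [::] = 1.
Proof.
have box0 (b : box [::]) : False by case: b => -[].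
have tE (t : {ffun box [::] -> 'I_(sumn [::])}) : is_standard t.
  apply/and3P; split; apply/forallP; try by move=> b; case: (box0 b).
  by case.
rewrite /dimension (eq_card (B := predT)); last by move=> t; rewrite !inE tE.
rewrite -[LHS]/(#|{: {ffun box [::] -> 'I_(sumn [::])}}|) card_ffun.
rewrite (_ : #|box [::]| = 0) ?expn0 //.
by apply: eq_card0 => b; case: (box0 b).
Qed.

Lemma a_mod4_0 (i : nat) : a_mod4 i 0 = (1 == i %[mod 4]).
Proof.
have bE (la : {bseq 0 of 'I_1}) : la = [bseq].
  by apply: val_inj; case: la => -[].
rewrite /a_mod4; have [Hi|Hi] := boolP (1 == i %[mod 4]).
  by apply/eqP/cards1P; exists [bseq]; apply/setP => la;
    rewrite !inE (bE la) /= dimension_nil Hi eqxx.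
by apply: eq_card0 => la; rewrite !inE (bE la) /= dimension_nil (negPf Hi).
Qed.

(* Main.v *)
(* A partition with k rows (possibly zero) is encoded by its beta-set X, the set
   of the la_i + k - 1 - i; boxes correspond to the pairs z < x with x in X and z
   not in X, with hook length x - z.  Splitting X by parity gives a 2-core and
   two partitions (the 2-quotient): even hooks are twice the hooks of the
   quotient, so w(la) = |la| - v_2(product of hooks) is the size of the core
   plus the w's of the quotient.  By Legendre, v_2(f^la) = w(la) - s(n), s the
   binary digit sum.  Hence G(x, y) = sum_la x^|la| y^w(la) satisfies
   G(x, y) = theta(x y) G(x^2, y)^2, theta the generating function of 2-cores.
   Since s(q) <= s(q - r) + r, only the core sizes b (for w = s(n)), and b and
   b + 2 (for w = s(n) + 1), contribute to the coefficient of x^(2q + b) in a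
   power of G, b being a bit; this gives recursions in n for all the powers
   G^(2^j) at once, and the theorem follows by induction on R. *)
Require Import Defs.
From mathcomp Require Import all_boot all_order all_algebra perm.
From mathcomp Require Import zify ring.

Set Implicit Arguments.
Unset Strict Implicit.
Unset Printing Implicit Defensive.

Import Order.TTheory GRing.Theory Num.Theory.
Local Open Scope nat_scope.

(** * Linear extensions *)

Section LinearExtensions.
Variables (U : finType) (R : rel U) (n : nat) (d0 : 'I_n).

(** Pinning [t] to the dummy value [d0] outside [D] makes each labelling of [D] a single function on
    all of [U], so that deleting a point of [D] changes no type. *)
Definition linext (D : {set U}) (t : {ffun U -> 'I_n}) : bool :=
  [&& [forall p, (p \notin D) ==> (t p == d0)],
      [forall p, (p \in D) ==> (t p < #|D|)],
      [forall p, forall q, [&& p \in D, q \in D & t p == t q] ==> (p == q)]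
    & [forall p, forall q, [&& p \in D, q \in D & R p q] ==> (t p < t q)]].

Lemma linextP (D : {set U}) (t : {ffun U -> 'I_n}) :
  reflect [/\ forall p, p \notin D -> t p = d0,
              forall p, p \in D -> t p < #|D|,
              {in D &, injective t}
            & {in D &, forall p q, R p q -> t p < t q}]
          (linext D t).
Proof.
apply: (iffP and4P) => [[/forallP h1 /forallP h2 /forallP h3 /forallP h4]|[h1 h2 h3 h4]].
  split=> [p pD|p pD|p q pD qD e|p q pD qD r].
  - by apply/eqP; apply: (implyP (h1 p)).
  - exact: (implyP (h2 p)).
  - by apply/eqP; apply: (implyP (forallP (h3 p) q)); rewrite pD qD e eqxx.
  - by apply: (implyP (forallP (h4 p) q)); rewrite pD qD.
split; apply/forallP => p.
- by apply/implyP => /h1 ->.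
- by apply/implyP => /h2.
- by apply/forallP => q; apply/implyP => /and3P[pD qD /eqP e]; rewrite (h3 p q).
- by apply/forallP => q; apply/implyP => /and3P[pD qD]; apply: h4.
Qed.

Definition nlinext (D : {set U}) : nat := #|[set t | linext D t]|.

Lemma nlinext0 : nlinext set0 = 1.
Proof.
apply/eqP/cards1P; exists [ffun=> d0]; apply/setP => t; rewrite !inE.
apply/linextP/eqP => [[h _ _ _]|->].
  by apply/ffunP => p; rewrite ffunE h ?inE.
by split=> [p _|p|p q|p q]; rewrite ?inE // ffunE.
Qed.

Definition maximal_in (D : {set U}) (c : U) : bool :=
  (c \in D) && [forall p, (p \in D) ==> ~~ R c p].

(** Pigeonhole: otherwise the injective [t] would send [D] into [#|D|.-1] values. *)
Lemma linext_top (D : {set U}) (t : {ffun U -> 'I_n}) :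
  D != set0 -> #|D| <= n -> linext D t ->
  exists2 c, c \in D & t c = #|D|.-1 :> nat.
Proof.
move=> D0 Dn /linextP[_ h2 h3 _].
have D1 : 0 < #|D| by rewrite card_gt0.
case: (pickP [pred c | (c \in D) && (t c == #|D|.-1 :> nat)]) => /= [c /andP[cD /eqP e]|h].
  by exists c.
have lt p : p \in D -> t p < #|D|.-1.
  by move=> pD; have := h2 p pD; have /= := h p; rewrite pD /=; lia.
have n_ge : #|D|.-1 <= n by lia.
have : #|t @: D| <= #|[set widen_ord n_ge i | i : 'I_#|D|.-1]|.
  apply/subset_leq_card/subsetP => _ /imsetP[p pD ->].
  by apply/imsetP; exists (Ordinal (lt p pD)) => //; apply: val_inj.
rewrite card_in_imset //.
move/leq_trans/(_ (leq_imset_card _ _)); rewrite card_ord; lia.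
Qed.

Lemma nlinext_fiber (D : {set U}) (c : U) :
  #|D| <= n -> maximal_in D c ->
  #|[set t | linext D t & t c == #|D|.-1 :> nat]| = nlinext (D :\ c).
Proof.
move=> Dn /andP[cD /forallP cmax].
have D1 : 0 < #|D| by apply/card_gt0P; exists c.
have cardD : #|D| = #|D :\ c|.+1 by rewrite (cardsD1 c) cD.
have top_lt : #|D|.-1 < n by lia.
(* [ext d0] erases the label of [c], and [ext] at the value [#|D|.-1] restores it; maximality of [c]
   makes the restored labelling increasing. *)
pose ext v (t : {ffun U -> 'I_n}) := [ffun p => if p == c then v else t p] : {ffun U -> 'I_n}.
have Rc p : p \in D -> R c p = false by move=> pD; apply/negbTE/(implyP (cmax p)).
rewrite /nlinext -(card_in_imset (f := ext d0)); last first.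
  move=> t t'; rewrite !inE => /andP[_ /eqP e] /andP[_ /eqP e'] /ffunP h.
  apply/ffunP => p; have := h p; rewrite !ffunE.
  by case: eqP => // -> _; apply: val_inj; rewrite /= e e'.
apply: eq_card => t'; rewrite inE; apply/imsetP/linextP.
  move=> [t]; rewrite inE => /andP[/linextP[h1 h2 h3 h4] /eqP e] ->.
  split=> [p|p|p q|p q].
  - by rewrite !inE ffunE; case: eqP => //= _; apply: h1.
  - rewrite !inE ffunE; case: (p =P c) => //= pc pD.
    have := h2 p pD; rewrite cardD ltnS leq_eqVlt => /orP[/eqP e2|//].
    by case: pc; apply: h3 => //; apply: val_inj; rewrite /= e e2 cardD.
  - rewrite !inE !ffunE => /andP[/negPf -> pD] /andP[/negPf -> qD].
    exact: h3.
  - rewrite !inE !ffunE => /andP[/negPf -> pD] /andP[/negPf -> qD].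
    exact: h4.
move=> [h1 h2 h3 h4]; exists (ext (Ordinal top_lt) t'); last first.
  by apply/ffunP => p; rewrite !ffunE; case: eqP => // ->; rewrite h1 // !inE eqxx.
have ltD p : p \in D -> p != c -> t' p < #|D|.-1.
  by move=> pD pc; rewrite cardD /= h2 // !inE pc.
rewrite inE ffunE eqxx /= eqxx andbT; apply/linextP; split=> [p pD|p pD|p q pD qD|p q pD qD].
- rewrite ffunE; case: (p =P c) => [e|_]; first by rewrite e cD in pD.
  by apply: h1; rewrite !inE negb_and pD orbT.
- rewrite ffunE; case: (p =P c) => [_|/eqP pc] /=; first by lia.
  by apply: leq_trans (ltD p pD pc) _; lia.
- rewrite !ffunE; case: (p =P c) => [->|/eqP pc]; case: (q =P c) => [->|/eqP qc] //.
  + by move/(congr1 val) => /= e; have := ltD q qD qc; rewrite -e ltnn.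
  + by move/(congr1 val) => /= e; have := ltD p pD pc; rewrite -e ltnn.
  + by apply: h3; rewrite !inE ?pc ?qc.
- rewrite !ffunE; case: (p =P c) => [->|/eqP pc]; first by rewrite Rc.
  case: (q =P c) => [->|/eqP qc] /=; first by move=> _; apply: ltD.
  by apply: h4; rewrite !inE ?pc ?qc.
Qed.

(** Linear extensions are sorted by the point that carries the top label, which is necessarily
    maximal. Aitken's determinant will be shown to obey the same recursion. *)
Lemma nlinext_rec (D : {set U}) : D != set0 -> #|D| <= n ->
  nlinext D = \sum_(c | maximal_in D c) nlinext (D :\ c).
Proof.
move=> D0 Dn.
have D1 : 0 < #|D| by rewrite card_gt0.
under eq_bigr => c cmax do rewrite -(nlinext_fiber Dn cmax) -sum1_card.
rewrite (exchange_big_dep (mem [set t | linext D t])) /=; last first.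
  by move=> c t _; rewrite !inE => /andP[].
rewrite /nlinext -sum1_card; apply: eq_bigr => t; rewrite inE => ht.
have [c cD e] := linext_top D0 Dn ht.
have /linextP[h1 h2 h3 h4] := ht.
rewrite (big_pred1 c) // => c' /=; rewrite inE ht /=.
apply/andP/eqP => [[/andP[c'D _] /eqP e']|->].
  by apply: h3 => //; apply: val_inj; rewrite /= e'.
rewrite e eqxx /maximal_in cD; split=> //; apply/forallP => p.
apply/implyP => pD; apply/negP => Rcp.
by have := h2 p pD; have := h4 c p cD pD Rcp; rewrite e; lia.
Qed.

End LinearExtensions.

(** * Aitken's determinant *)

Section Aitken.
Local Open Scope ring_scope.

(** The convention that 1/r! is zero for negative r makes [inv_fact_subS] hold for all [x] and
    [j]. *)
Definition inv_fact_sub (x j : nat) : rat :=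
  if (j <= x)%N then ((x - j)`!)%:R^-1 else 0.

Lemma inv_fact_subS (x j : nat) :
  inv_fact_sub x j.+1 = (x%:R - j%:R) * inv_fact_sub x j.
Proof.
rewrite /inv_fact_sub; case: (ltngtP j x) => [jx|jx|->]; last by rewrite subrr mul0r.
- rewrite -natrB; last exact: ltnW.
  rewrite (_ : (x - j = (x - j.+1).+1)%N); last by lia.
  rewrite factS natrM invfM mulrA divff ?mul1r // pnatr_eq0; lia.
- by rewrite mulr0.
Qed.

(** The falling factorial is a monic polynomial of degree [j] in [x]; this is what reduces [aitken]
    to a Vandermonde determinant. *)
Lemma inv_fact_sub_fact (x j : nat) :
  inv_fact_sub x j * x`!%:R = \prod_(l < j) (x%:R - l%:R).
Proof.
elim: j => [|j IHj].
  by rewrite big_ord0 /inv_fact_sub subn0 mulVf // pnatr_eq0 -lt0n fact_gt0.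
by rewrite big_ord_recr /= -IHj inv_fact_subS; ring.
Qed.

(** At the beta-numbers of a partition of n this is the dimension divided by n!; see
    [dimension_aitken]. *)
Definition aitken (k : nat) (x : 'I_k -> nat) : rat :=
  \det (\matrix_(i, j) inv_fact_sub (x i) j).

Lemma aitken_ext (k : nat) (x y : 'I_k -> nat) : x =1 y -> aitken x = aitken y.
Proof. by move=> e; congr (\det _); apply/matrixP => i j; rewrite !mxE e. Qed.

Lemma aitken_id (k : nat) : aitken (fun i : 'I_k => i : nat) = 1.
Proof.
rewrite /aitken det_trig; last first.
  apply/is_trig_mxP => i j ij; rewrite mxE /inv_fact_sub leqNgt ij //.
by apply: big1 => i _; rewrite mxE /inv_fact_sub leqnn subnn invr1.
Qed.

(* Each term of the Leibniz expansion picks up the factor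
   [sum_i (x_i - s_i)], which does not depend on the permutation [s]. *)
Lemma aitken_sum_shift (k : nat) (x : 'I_k -> nat) :
  \sum_(i < k) \det (\matrix_(i', j) inv_fact_sub (x i') (j + (i' == i)))
  = ((\sum_i x i)%:R - (\sum_(i < k) i)%:R) * aitken x.
Proof.
rewrite /aitken /determinant exchange_big mulr_sumr; apply: eq_bigr => s _.
rewrite (_ : (\sum_i x i)%:R - _ = \sum_i ((x i)%:R - (s i : nat)%:R) :> rat); last first.
  rewrite sumrB !natr_sum; congr (_ - _).
  by rewrite (reindex_inj (@perm_inj _ s)).
rewrite mulr_suml; apply: eq_bigr => i _; rewrite [RHS]mulrCA; congr (_ * _).
rewrite (bigD1 i) //= [in RHS](bigD1 i) //= !mxE eqxx addn1 inv_fact_subS -mulrA.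
congr (_ * (_ * _)); apply: eq_bigr => i' i'i.
by rewrite !mxE (negPf i'i) addn0.
Qed.

(** Shifting the column index in row [i] amounts to lowering [x i] by one, that is, to removing a
    box from one row of the diagram. *)
Lemma aitken_shift_pred (k : nat) (x : 'I_k -> nat) (i : 'I_k) :
  (0 < x i)%N ->
  \det (\matrix_(i', j) inv_fact_sub (x i') (j + (i' == i)))
  = aitken (fun i' => (x i' - (i' == i))%N).
Proof.
move=> xi; congr (\det _); apply/matrixP => i' j; rewrite !mxE.
case: eqP => [->|_]; last by rewrite addn0 subn0.
rewrite /inv_fact_sub addn1 subn1 (_ : (j < x i) = (j <= (x i).-1))%N; last by lia.
by rewrite (_ : (x i - j.+1 = (x i).-1 - j)%N) //; lia.
Qed.

Lemma aitken_shift0 (k : nat) (x : 'I_k -> nat) (i : 'I_k) :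
  x i = 0%N ->
  \det (\matrix_(i', j) inv_fact_sub (x i') (j + (i' == i))) = 0.
Proof.
move=> xi; rewrite /determinant big1 // => s _.
by rewrite (bigD1 i) //= !mxE eqxx xi addn1 /inv_fact_sub /= mul0r mulr0.
Qed.

(** The shifted row [i] coincides with row [i']: a removal that would not leave a partition
    contributes nothing. *)
Lemma aitken_shift_eq (k : nat) (x : 'I_k -> nat) (i i' : 'I_k) :
  i != i' -> x i = (x i').+1 ->
  \det (\matrix_(i', j) inv_fact_sub (x i') (j + (i' == i))) = 0.
Proof.
move=> ii' xi; apply: (determinant_alternate ii') => j; rewrite !mxE eqxx.
rewrite eq_sym (negPf ii') xi addn0 addn1 /inv_fact_sub ltnS.
by rewrite subSS.
Qed.

(** The matrix is a Vandermonde matrix times the coefficient matrix of the [p j], which is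
    triangular with unit diagonal. *)
Lemma det_monic_horner (F : fieldType) (k : nat) (p : nat -> {poly F})
    (a : 'I_k -> F) :
  (forall j, p j \is monic) -> (forall j, size (p j) = j.+1) ->
  \det (\matrix_(i < k, j < k) (p j).[a i])
  = \prod_(i < k) \prod_(j < k | (i < j)%N) (a j - a i).
Proof.
move=> pmon psize.
have -> : \matrix_(i < k, j < k) (p j).[a i]
  = (Vandermonde k (\row_i a i))^T *m \matrix_(l < k, j < k) (p j)`_l.
  apply/matrixP => i j; rewrite !mxE (@horner_coef_wide _ k); last first.
    by rewrite psize.
  by apply: eq_bigr => l _; rewrite !mxE mulrC.
rewrite det_mulmx det_tr det_Vandermonde -[\det (\matrix_(l, j) _)]det_tr det_trig.
  rewrite [X in _ * X]big1 ?mulr1; last first.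
    move=> i _; rewrite !mxE.
    by have /monicP := pmon i; rewrite lead_coefE psize.
  by apply: eq_bigr => i _; apply: eq_bigr => j _; rewrite !mxE.
apply/is_trig_mxP => i j ij; rewrite !mxE nth_default // psize //.
Qed.

(** Multiplying row [i] by the factorial of [x i] turns its entries into falling factorials, to
    which [det_monic_horner] applies. *)
Lemma aitkenE (k : nat) (x : 'I_k -> nat) :
  aitken x * \prod_i (x i)`!%:R
  = \prod_(i < k) \prod_(j < k | (i < j)%N) ((x j)%:R - (x i)%:R).
Proof.
pose p j : {poly rat} := \prod_(l < j) ('X - (l : nat)%:R%:P).
rewrite -(@det_monic_horner _ _ p); first last.
- by move=> j; rewrite size_prod_XsubC -[index_enum _]enumT size_enum_ord.
- by move=> j; apply: monic_prod_XsubC.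
rewrite /aitken mulrC.
rewrite (_ : \prod_i (x i)`!%:R = \det (diag_mx (\row_i (x i)`!%:R : 'rV[rat]_k))); last first.
  by rewrite det_diag; apply: eq_bigr => i _; rewrite !mxE.
rewrite -det_mulmx; congr (\det _); apply/matrixP => i j.
rewrite mul_diag_mx !mxE mulrC inv_fact_sub_fact horner_prod.
by apply: eq_bigr => l _; rewrite !hornerE.
Qed.

End Aitken.

(** * Dimension as a determinant *)

Lemma box_inj (la : seq nat) (b b' : box la) :
  box_row b = box_row b' -> box_col b = box_col b' -> b = b'.
Proof.
case: b b' => r c [r' c']; rewrite /box_row /box_col /= => /val_inj e.
by subst r' => /val_inj ->.
Qed.

Lemma mk_box (la : seq nat) (r c : nat) :
  c < nth 0 la r -> exists b : box la, box_row b = r /\ box_col b = c.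
Proof.
move=> hc; have hr : r < size la.
  by rewrite ltnNge; apply/negP => h; rewrite nth_default in hc.
by exists (Tagged (fun r : 'I_(size la) => 'I_(nth 0 la r)) (i := Ordinal hr) (Ordinal hc)).
Qed.

Lemma card_box (la : seq nat) : #|box la| = sumn la.
Proof.
rewrite card_tagged sumnE big_map big_enum /=.
under eq_bigr do rewrite card_ord.
by rewrite sumnE (big_nth 0) big_mkord.
Qed.

Definition box_lt (la : seq nat) : rel (box la) :=
  [rel b b' | (box_row b == box_row b') && (box_col b < box_col b')
           || (box_col b == box_col b') && (box_row b < box_row b')].

Lemma dimension_linext (la : seq nat) (d0 : 'I_(sumn la)) :
  dimension la = nlinext (@box_lt la) d0 [set: box la].
Proof.
rewrite /dimension /nlinext; congr #|pred_of_set _|; apply/setP => t; rewrite !inE.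
apply/and3P/linextP => [[/forallP h1 /forallP h2 /forallP h3]|[_ _ h3 h4]].
  split=> [b|b _|b b' _ _ e|b b' _ _ /orP[]].
  - by rewrite inE.
  - by rewrite cardsT card_box.
  - have /cards1P[c /setP hc] := h1 (t b).
    have := hc b; have := hc b'; rewrite !inE e eqxx.
    by move=> /esym/eqP -> /esym/eqP.
  - exact: (implyP (forallP (h2 b) b')).
  - exact: (implyP (forallP (h3 b) b')).
have tinj : injective t by move=> b b'; apply: h3; rewrite inE.
have [g tg gt] : bijective t by apply: inj_card_bij => //; rewrite card_ord card_box.
split.
- apply/forallP => k; apply/cards1P; exists (g k); apply/setP => b.
  by rewrite !inE; apply/eqP/eqP => [<-|->].
- apply/forallP => b; apply/forallP => b'; apply/implyP => h.
  by apply: h4; rewrite ?inE // /box_lt /= h.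
- apply/forallP => b; apply/forallP => b'; apply/implyP => h.
  by apply: h4; rewrite ?inE // /box_lt /= h orbT.
Qed.

(** * Subdiagrams of a fixed shape and removal of corners *)

Section SubDiagram.
Variables (la : seq nat) (d0 : 'I_(sumn la)) (k : nat).
Hypothesis la_k : size la <= k.

(** Smaller partitions are kept as sets of boxes of the fixed [la], so that the induction on the
    size stays in one type. *)
Definition diagram (mu : nat -> nat) : {set box la} :=
  [set b | box_col b < mu (box_row b)].

Definition remove_box (mu : nat -> nat) (r : nat) : nat -> nat :=
  fun r' => mu r' - (r' == r).

Lemma box_row_lt (b : box la) : box_row b < k.
Proof. by apply: leq_trans la_k; rewrite /box_row; case: b. Qed.

Lemma maximal_diagram (mu : nat -> nat) (b : box la) :
  {homo mu : i j / i <= j >-> j <= i} -> (forall r, mu r <= nth 0 la r) ->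
  maximal_in (@box_lt la) (diagram mu) b
  = (mu (box_row b).+1 < mu (box_row b)) && (box_col b == (mu (box_row b)).-1).
Proof.
move=> mono sub; apply/andP/andP.
  rewrite inE => -[bD /forallP bmax].
  have notlt b' : b' \in diagram mu -> ~~ box_lt b b' by apply/implyP/bmax.
  split.
    rewrite ltnNge; apply/negP => h.
    have [|b' [rE cE]] := @mk_box la (box_row b).+1 (box_col b).
      by apply: leq_trans bD _; apply: leq_trans h (sub _).
    have := notlt b'; rewrite inE /box_lt /= rE cE eqxx ltnSn orbT => /(_ _)/negP.
    by apply=> //; apply: leq_trans bD h.
  rewrite eqn_leq; apply/andP; split; first by lia.
  rewrite leqNgt; apply/negP => h.
  have [|b' [rE cE]] := @mk_box la (box_row b) (box_col b).+1.
    by apply: leq_trans (sub _); lia.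
  have := notlt b'; rewrite inE /box_lt /= rE cE eqxx ltnSn /= => /(_ _)/negP.
  by apply=> //; lia.
move=> [h /eqP e]; rewrite inE e; split; first by lia.
apply/forallP => b'; rewrite inE; apply/implyP => b'D; apply/negP => /orP[] /andP[/eqP er lt].
  by move: b'D lt; rewrite -er e; lia.
have := mono _ _ lt; move: b'D; rewrite -er e; lia.
Qed.

Lemma diagram_remove (mu : nat -> nat) (b : box la) :
  0 < mu (box_row b) -> box_col b = (mu (box_row b)).-1 ->
  diagram mu :\ b = diagram (remove_box mu (box_row b)).
Proof.
move=> h e; apply/setP => b'; rewrite !inE /remove_box.
case: (box_row b' =P box_row b) => [er|ner]; last first.
  by rewrite subn0; case: eqP => [e'|//]; rewrite e' in ner.
rewrite er subn1; case: (b' =P b) => [->|ne] /=; first by lia.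
suff : box_col b' <> box_col b by lia.
by move=> ec; apply: ne; apply: box_inj.
Qed.

Lemma sum_maximal_diagram (mu : nat -> nat) (F : {set box la} -> nat) :
  {homo mu : i j / i <= j >-> j <= i} -> (forall r, mu r <= nth 0 la r) ->
  \sum_(b | maximal_in (@box_lt la) (diagram mu) b) F (diagram mu :\ b)
  = \sum_(r < k | mu r.+1 < mu r) F (diagram (remove_box mu r)).
Proof.
move=> mono sub.
rewrite (partition_big (fun b => Ordinal (box_row_lt b))
  (fun r : 'I_k => mu r.+1 < mu r)) /=; last first.
  by move=> b; rewrite maximal_diagram // => /andP[].
apply: eq_bigr => r hr.
have [|b0 [rE cE]] := @mk_box la r (mu r).-1.
  by apply: leq_trans (sub _); lia.
rewrite (big_pred1 b0); first by rewrite diagram_remove rE //; lia.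
move=> b /=; rewrite maximal_diagram //.
apply/andP/eqP => [[/andP[_ /eqP hc] /eqP/(congr1 val) /= hb]|->].
  by apply: box_inj; rewrite ?rE ?cE // hc hb.
by split; [rewrite rE cE hr eqxx | apply/eqP/val_inj].
Qed.

(** The index runs from the bottom row upwards, so that the beta-numbers of a partition increase
    with [i]. *)
Definition beta (mu : nat -> nat) (i : 'I_k) : nat := mu (k - i.+1) + i.

Lemma sum_beta (mu : nat -> nat) :
  \sum_i beta mu i = \sum_(r < k) mu r + \sum_(i < k) i.
Proof. by rewrite big_split /= [in RHS](reindex_inj rev_ord_inj). Qed.

(** Induction on the size: [nlinext_rec] removes corners, and [aitken_sum_shift] is the same
    recursion, its terms for rows without a corner being zero. *)
Lemma nlinext_aitken (mu : nat -> nat) :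
  {homo mu : i j / i <= j >-> j <= i} -> (forall r, mu r <= nth 0 la r) ->
  ((nlinext (@box_lt la) d0 (diagram mu))%:R
   = (\sum_(r < k) mu r)`!%:R * aitken (beta mu))%R.
Proof.
move sE: (\sum_(r < k) mu r) => s; elim: s mu sE => [|s IHs] mu sE mono sub.
  have mu0 r : r < k -> mu r = 0.
    move=> hr; apply/eqP; have /eqP := sE; rewrite sum_nat_eq0.
    by move=> /forallP/(_ (Ordinal hr))/implyP/(_ isT).
  have -> : diagram mu = set0.
    by apply/setP => b; rewrite !inE mu0 // box_row_lt.
  rewrite nlinext0 mul1r (@aitken_ext _ _ (fun i => i : nat)) ?aitken_id //.
  by move=> i; rewrite /beta mu0 //; have := ltn_ord i; lia.
rewrite nlinext_rec; first last.
- by rewrite (leq_trans (max_card _)) // card_box.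
- have : \sum_(r < k) mu r != 0 by rewrite sE.
  rewrite sum_nat_eq0 negb_forall => /existsP[r]; rewrite negb_imply /= => hr.
  have [|b [rE cE]] := @mk_box la r 0; first by apply: leq_trans (sub r); lia.
  by apply/set0Pn; exists b; rewrite inE rE cE; lia.
rewrite sum_maximal_diagram //.
have -> : ((s.+1)`!%:R * aitken (beta mu) = s`!%:R *
   \sum_(i < k) \det (\matrix_(i', j) inv_fact_sub (beta mu i') (j + (i' == i))))%R.
  rewrite aitken_sum_shift sum_beta sE factS natrM natrD; ring.
(* [rev_ord] matches the row [r] with the index [k - r.+1] of its beta-number. *)
rewrite natr_sum big_mkcond (reindex_inj rev_ord_inj) mulr_sumr /=.
apply: eq_bigr => i _; have ik := ltn_ord i; case: ifP => hr; last first.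
  (* Here the row can lose no box. If it is the last one, its length and its beta-number are zero;
     otherwise the row below has the same length, and the beta-numbers of indices [i.-1] and [i] are
     consecutive. *)
  have [i0|i0] := posnP (i : nat).
    case: (posnP (beta mu i)) => bi; first by rewrite aitken_shift0 ?mulr0.
    have muk : mu k = 0.
      by apply/eqP; rewrite -leqn0; apply: leq_trans (sub k) _; rewrite nth_default.
    have e : (k - i.+1).+1 = k by lia.
    move: hr bi; rewrite /beta e muk i0 addn0; lia.
  have h : i.-1 < k by lia.
  rewrite (@aitken_shift_eq _ _ _ (Ordinal h)) ?mulr0 //.
    by rewrite -val_eqE /=; lia.
  have := mono _ _ (leqnSn (k - i.+1)); rewrite /beta /= prednK //.
  have e : (k - i.+1).+1 = k - i by lia.
  by rewrite e in hr *; lia.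
rewrite IHs.
- congr (_ * _)%R; rewrite aitken_shift_pred; last by rewrite /beta; lia.
  apply: aitken_ext => i'; rewrite /beta /remove_box.
  have i'k := ltn_ord i'.
  have -> : (k - i'.+1 == k - i.+1) = (i' == i) by rewrite -val_eqE /=; lia.
  case: (i' =P i) => [->|_]; last by rewrite !subn0.
  by lia.
- have H : \sum_(r < k | r != rev_ord i) remove_box mu (k - i.+1) r
           = \sum_(r < k | r != rev_ord i) mu r.
    apply: eq_bigr => r hr'.
    by rewrite /remove_box -[k - i.+1]/(val (rev_ord i)) val_eqE (negPf hr') subn0.
  have := sE; rewrite (bigD1 (rev_ord i)) //= [in X in _ -> X](bigD1 (rev_ord i)) //= H.
  by rewrite /remove_box /= eqxx subn1; move: hr; set S := \sum_(_ < _ | _) _; lia.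
- move=> a b ab; rewrite /remove_box; have := mono _ _ ab.
  case: (a =P k - i.+1) => [ea|na]; case: (b =P k - i.+1) => [eb|nb]; try lia.
  have ab' : (k - i.+1).+1 <= b by lia.
  by have := mono _ _ ab'; rewrite ea; lia.
- by move=> r; apply: leq_trans (sub r); apply: leq_subr.
Qed.

End SubDiagram.

Lemma sorted_geq_nth (la : seq nat) : sorted geq la ->
  {homo nth 0 la : i j / i <= j >-> j <= i}.
Proof.
move=> la_sorted i j ij; case: (ltnP j (size la)) => hj; last by rewrite [X in X <= _]nth_default.
have geq_trans : transitive geq by move=> a b c /= h1 h2; apply: leq_trans h1.
have := sorted_leq_nth geq_trans leqnn 0 la_sorted.
by move=> /(_ i j); rewrite !inE; apply => //; apply: leq_ltn_trans hj.
Qed.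

Lemma sum_nth_sumn (la : seq nat) (k : nat) : size la <= k ->
  \sum_(r < k) nth 0 la r = sumn la.
Proof.
move=> hk; rewrite sumnE (big_nth 0) -(big_mkord xpredT (nth 0 la)).
rewrite (big_cat_nat (n := size la)) //= [X in _ + X]big_nat_cond [X in _ + X]big1 ?addn0 //.
by move=> i /andP[/andP[h _] _]; rewrite nth_default.
Qed.

Lemma dimension_aitken (la : seq nat) (k : nat) :
  sorted geq la -> size la <= k ->
  ((dimension la)%:R = (sumn la)`!%:R * aitken (@beta k (nth 0 la)))%R.
Proof.
(* The empty shape is treated apart, since ['I_0] offers no default value [d0]. *)
move=> la_sorted hk; have [s0|s0] := posnP (sumn la); last first.
  rewrite (dimension_linext (Ordinal s0)) -[X in (X`!%:R)%R](sum_nth_sumn hk).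
  rewrite -(nlinext_aitken (Ordinal s0)) //; last exact: sorted_geq_nth.
  congr ((nlinext _ _ _)%:R)%R; apply/setP => b; rewrite !inE /box_col /box_row.
  by case: b => r c /=; rewrite ltn_ord.
have nth0 r : nth 0 la r = 0.
  elim: la s0 r {la_sorted hk} => [|x la IH] /=; first by move=> _ [].
  by move/eqP; rewrite addn_eq0 => /andP[/eqP -> /eqP/IH h] [].
rewrite (@aitken_ext _ _ (fun i => i : nat)) ?aitken_id; last by move=> i; rewrite /beta nth0.
have box0 (b : box la) : False by case: b => r [c]; rewrite nth0.
rewrite s0 mulr1 (_ : dimension la = 1) // /dimension.
apply/eqP; rewrite (@eq_card _ _ predT).
  rewrite -[#|_|]/(#|{: {ffun box la -> 'I_(sumn la)}}|) card_ffun.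
  by rewrite card_box s0 expn0.
move=> t; rewrite !inE; apply/and3P; split; apply/forallP; try by move=> b; case: (box0 b).
by case=> i hi; exfalso; move: hi; rewrite s0.
Qed.

(** * Beta-sets and the hook length formula *)

Lemma logn2_odd (m : nat) : odd m -> logn 2 m = 0.
Proof. by rewrite -coprime2n; apply: logn_coprime. Qed.

Lemma logn_prod (I : finType) (P : pred I) (F : I -> nat) :
  (forall i, P i -> 0 < F i) ->
  logn 2 (\prod_(i | P i) F i) = \sum_(i | P i) logn 2 (F i).
Proof.
move=> F0.
pose K (a b : nat) := (0 < a) && (logn 2 a == b).
suff : K (\prod_(i | P i) F i) (\sum_(i | P i) logn 2 (F i)) by case/andP => _ /eqP.
apply: (big_ind2 K) => // [a b c d /andP[a0 /eqP ab] /andP[c0 /eqP cd]|i Pi].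
  by rewrite /K muln_gt0 a0 c0 lognM // ab cd /=.
by rewrite /K F0 //=.
Qed.

Lemma logn2_double (m : nat) : 0 < m -> logn 2 m.*2 = (logn 2 m).+1.
Proof. by move=> m0; rewrite -mul2n lognM // logn_prime. Qed.

(** Odd factors contribute nothing; the even factors 2, 4, ..., 2q each give one 2, besides those of
    1, 2, ..., q. *)
Lemma logn2_fact_double (q : nat) (b : bool) :
  logn 2 (b + q.*2)`! = q + logn 2 q`!.
Proof.
have even_case : logn 2 (q.*2)`! = q + logn 2 q`!.
  elim: q => // r IHr; rewrite doubleS !factS -doubleS.
  rewrite !lognM ?fact_gt0 ?muln_gt0 ?fact_gt0 ?double_gt0 // IHr logn2_double //.
  by rewrite (@logn2_odd r.*2.+1) ?oddS ?odd_double //; lia.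
case: b => //; rewrite add1n factS lognM ?fact_gt0 // even_case.
by rewrite (@logn2_odd q.*2.+1) ?oddS ?odd_double.
Qed.

(** This makes the truncated subtraction in [bitsum] exact. *)
Lemma logn2_fact_le (n : nat) : logn 2 n`! <= n.
Proof.
elim/ltn_ind: n => n IHn; have [->//|n0] := posnP n.
rewrite -(odd_double_half n) logn2_fact_double.
have := IHn n./2; have := odd_double_half n; lia.
Qed.

(* Legendre: this is the number of binary digits 1 of [n]. *)
Definition bitsum (n : nat) : nat := n - logn 2 n`!.

Lemma bitsum_double (q : nat) (b : bool) : bitsum (b + q.*2) = b + bitsum q.
Proof. by rewrite /bitsum logn2_fact_double; have := logn2_fact_le q; lia. Qed.

Lemma bitsum0 : bitsum 0 = 0. Proof. by []. Qed.

Lemma bitsum_le (n : nat) : bitsum n <= n.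
Proof. exact: leq_subr. Qed.

(** By Kummer, the difference of the two sides is the 2-adic valuation of a binomial coefficient. *)
Lemma bitsumD (m n : nat) : bitsum (m + n) <= bitsum m + bitsum n.
Proof.
have := bin_fact (leq_addl m n); rewrite addnK => /(congr1 (logn 2)).
rewrite !lognM ?muln_gt0 ?fact_gt0 ?bin_gt0 ?leq_addl //.
have := logn2_fact_le m; have := logn2_fact_le n; have := logn2_fact_le (m + n).
rewrite /bitsum; lia.
Qed.

Lemma fact_prod_ord (L : nat) (x : 'I_L) : \prod_(z < L | z < x) (x - z) = x`!.
Proof. by rewrite -ffactnn ffact_prod (big_ord_widen L (fun z => x - z)) // ltnW. Qed.

Lemma count_ord_lt (L : nat) (x : 'I_L) : \sum_(z < L | z < x) 1 = x.
Proof.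
have /esym := @big_ord_widen nat 0 addn x L (fun=> 1) (ltnW (ltn_ord x)).
by move=> ->; rewrite sum1_card card_ord.
Qed.

Section Hooks.
Variable (L : nat).
Implicit Types X : {set 'I_L}.

(* If [X] is the beta-set of a partition, its boxes correspond to the pairs
   [z < x] with [x] in [X] and [z] outside [X], the hook length being [x - z]. *)
Definition nhooks X : nat := \sum_(x in X) \sum_(z | (z \notin X) && (z < x)) 1.
Definition hook_prod X : nat :=
  \prod_(x in X) \prod_(z | (z \notin X) && (z < x)) (x - z).
Definition hook_val X : nat :=
  \sum_(x in X) \sum_(z | (z \notin X) && (z < x)) logn 2 (x - z).

Lemma hook_prod_gt0 X : 0 < hook_prod X.
Proof.
apply: prodn_cond_gt0 => x _; apply: prodn_cond_gt0 => z /andP[_ zx].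
by rewrite subn_gt0.
Qed.

Lemma logn_hook_prod X : logn 2 (hook_prod X) = hook_val X.
Proof.
rewrite logn_prod => [|x _]; last first.
  by apply: prodn_cond_gt0 => z /andP[_ zx]; rewrite subn_gt0.
apply: eq_bigr => x _; rewrite logn_prod // => z /andP[_ zx].
by rewrite subn_gt0.
Qed.

Definition beta_seq (k : nat) (la : seq nat) : seq nat :=
  mkseq (fun i => nth 0 la (k - i.+1) + i) k.

Definition vals X : seq nat := map val (enum X).

Lemma vals_sorted X : sorted ltn (vals X).
Proof.
have : subseq (vals X) (iota 0 L).
  by rewrite -val_enum_ord; apply/map_subseq; rewrite {1}/enum_mem -enumT filter_subseq.
by move/(subseq_sorted ltn_trans); apply; apply: iota_ltn_sorted.
Qed.

Lemma vals_inj : injective vals.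
Proof.
move=> X Y /(inj_map val_inj) e; apply/setP => x.
by rewrite -mem_enum e mem_enum.
Qed.

Lemma size_vals X : size (vals X) = #|X|.
Proof. by rewrite size_map -cardE. Qed.

Lemma beta_seq_sorted (k : nat) (la : seq nat) : sorted geq la ->
  sorted ltn (beta_seq k la).
Proof.
move=> la_sorted; apply/(sortedP 0) => i; rewrite size_mkseq => ik.
rewrite !nth_mkseq //; last exact: ltnW.
have := sorted_geq_nth la_sorted (leq_sub2l k (leqnSn i.+1)); lia.
Qed.

Section BetaSet.
Variables (X : {set 'I_L}) (k : nat) (la : seq nat).
Hypothesis XE : vals X = beta_seq k la.
Hypothesis la_sorted : sorted geq la.
Hypothesis la_k : size la <= k.

Let b : 'I_k -> nat := @beta k (nth 0 la).

Lemma card_beta_set : #|X| = k.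
Proof. by rewrite -size_vals XE size_mkseq. Qed.

Lemma big_beta_set (T : Type) (idx : T) (op : Monoid.com_law idx)
    (P : pred nat) (F : nat -> T) :
  \big[op/idx]_(x in X | P x) F x = \big[op/idx]_(i < k | P (b i)) F (b i).
Proof.
rewrite -big_enum_cond -(big_map val P F) -/(vals X) XE /beta_seq /mkseq big_map.
by rewrite -[k in iota 0 k]subn0 -/(index_iota 0 k) big_mkord.
Qed.

Lemma beta_lt (i j : 'I_k) : (b i < b j) = (i < j).
Proof.
have mono (i' j' : 'I_k) : i' < j' -> b i' < b j'.
  move=> ij; have h : k - j'.+1 <= k - i'.+1 by lia.
  by have := sorted_geq_nth la_sorted h; rewrite /b /beta; lia.
case: (ltngtP i j) => [/mono//|/mono|/val_inj ->]; last by rewrite ltnn.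
by move=> h; apply/negbTE; rewrite -leqNgt ltnW.
Qed.

(** The factorial of [x] is the product of [x - z] over all [z < x]: the [z] outside [X] give the
    hook lengths, those in [X] the differences of beta-numbers. *)
Lemma prod_fact_beta :
  \prod_(i < k) (b i)`! =
  hook_prod X * \prod_(i < k) \prod_(j < k | i < j) (b j - b i).
Proof.
have h F : \prod_(i < k) F (b i) = \prod_(x in X) F (val x).
  by rewrite -(big_beta_set _ xpredT F); apply: eq_bigl => x; rewrite andbT.
rewrite (h (fun x => x`!)) /hook_prod.
have -> : \prod_(i < k) \prod_(j < k | i < j) (b j - b i)
        = \prod_(x in X) \prod_(i < k | b i < x) (x - b i).
  rewrite (exchange_big_dep xpredT) //= -(h (fun x => \prod_(i < k | b i < x) (x - b i))).
  by apply: eq_bigr => j _; apply: eq_bigl => i; rewrite beta_lt.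
rewrite -big_split /=; apply: eq_bigr => x xX.
rewrite -fact_prod_ord (bigID (mem X)) /= mulnC; congr (_ * _).
  by apply: eq_bigl => z; rewrite andbC.
rewrite -(big_beta_set _ (fun z => z < x) (fun z => x - z)).
by apply: eq_bigl => z; rewrite andbC.
Qed.

(** The additive analogue of [prod_fact_beta]: [x] counts the [z < x], split by membership in
    [X]. *)
Lemma sum_beta_set : \sum_(x in X) x = nhooks X + \sum_(i < k) i.
Proof.
have h F : \sum_(i < k) F (b i) = \sum_(x in X) F (val x).
  by rewrite -(big_beta_set _ xpredT F); apply: eq_bigl => x; rewrite andbT.
have -> : \sum_(j < k) j = \sum_(x in X) \sum_(i < k | b i < x) 1.
  rewrite -(h (fun x => \sum_(i < k | b i < x) 1)).
  apply: eq_bigr => j _; rewrite -[LHS]count_ord_lt.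
  by apply: eq_bigl => i; rewrite beta_lt.
rewrite -big_split /=; apply: eq_bigr => x xX.
rewrite -[LHS]count_ord_lt (bigID (mem X)) /= addnC; congr (_ + _).
  by apply: eq_bigl => z; rewrite andbC.
rewrite -(big_beta_set _ (fun z => z < x) (fun=> 1)).
by apply: eq_bigl => z; rewrite andbC.
Qed.

Lemma nhooks_beta_set : nhooks X = sumn la.
Proof.
apply/eqP; rewrite -(eqn_add2r (\sum_(i < k) i)) -sum_beta_set.
rewrite -(sum_nth_sumn la_k) -sum_beta -(big_beta_set _ xpredT id).
by apply/eqP; apply: eq_bigl => x; rewrite andbT.
Qed.

(** The product of differences occurs both in [aitkenE] and in [prod_fact_beta], and cancels. *)
Lemma hook_length_formula : dimension la * hook_prod X = (sumn la)`!.
Proof.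
apply/eqP; rewrite -(eqr_nat rat) natrM (dimension_aitken la_sorted la_k).
have pos : ((\prod_(i < k) \prod_(j < k | i < j) (b j - b i))%:R != 0 :> rat)%R.
  rewrite pnatr_eq0 -lt0n; apply: prodn_gt0 => i; apply: prodn_cond_gt0 => j ij.
  by rewrite subn_gt0 beta_lt.
apply/eqP/(mulIf pos); rewrite -2!mulrA -natrM -prod_fact_beta; congr (_ * _)%R.
rewrite natr_prod aitkenE natr_prod; apply: eq_bigr => i _.
rewrite natr_prod; apply: eq_bigr => j ij.
by rewrite natrB // ltnW // -/(b i) -/(b j) beta_lt.
Qed.

Lemma logn_dimension : logn 2 (dimension la) + hook_val X = logn 2 (sumn la)`!.
Proof.
have d0 : 0 < dimension la.
  by have := fact_gt0 (sumn la); rewrite -hook_length_formula muln_gt0 => /andP[].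
by rewrite -hook_length_formula lognM ?hook_prod_gt0 // logn_hook_prod.
Qed.

End BetaSet.

(** Zero parts stand at the end of a decreasing sequence, where the default value of [nth] replaces
    them. *)
Lemma nth_filter_pos (s : seq nat) (r : nat) : sorted geq s ->
  nth 0 (filter (leq 1) s) r = nth 0 s r.
Proof.
elim: s r => // x s IHs r xs; have s_sorted : sorted geq s := path_sorted xs.
rewrite /=; case: ltnP => hx; first by case: r => //= r; apply: IHs.
rewrite IHs //; have le0 := sorted_geq_nth xs (leq0n _).
have := le0 r.+1; have := le0 r; case: r => [|r] /=; lia.
Qed.

Lemma beta_set_surj X : exists la : seq nat,
  [/\ is_partition (nhooks X) la, size la <= #|X| & vals X = beta_seq #|X| la].
Proof.
set k := #|X|; set s := vals X; have sk : size s = k := size_vals X.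
have /(sortedP 0) s_lt := vals_sorted X; rewrite -/s sk in s_lt.
(* Subtracting [i] from the element of rank [i] inverts [beta_seq]; [s_ge] shows that nothing is
   truncated. *)
pose la0 := mkseq (fun r => nth 0 s (k - r.+1) - (k - r.+1)) k.
have la0_sorted : sorted geq la0.
  apply/(sortedP 0) => i; rewrite size_mkseq => ik; rewrite !nth_mkseq; try lia.
  have e : k - i.+1 = (k - i.+2).+1 by lia.
  rewrite e /=; have := s_lt (k - i.+2); lia.
have s_ge i : i < k -> i <= nth 0 s i.
  elim: i => // i IHi ik; have := s_lt i ik; have := IHi (ltnW ik); rewrite /=; lia.
pose la := filter (leq 1) la0.
have la_sorted : sorted geq la.
  by apply: sorted_filter la0_sorted => a c d /= h1 h2; apply: leq_trans h1.
have la_k : size la <= k by rewrite size_filter (leq_trans (count_size _ _)) // size_mkseq.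
have e : vals X = beta_seq k la.
  apply: (@eq_from_nth _ 0); first by rewrite size_vals size_mkseq.
  move=> i; rewrite size_vals => ik; rewrite nth_mkseq // nth_filter_pos //.
  rewrite nth_mkseq; last by lia.
  have -> : k - (k - i.+1).+1 = i by lia.
  by rewrite subnK // s_ge.
exists la; split=> //; apply/and3P; split=> //; first exact: filter_all.
by rewrite (nhooks_beta_set e).
Qed.

(** By the hook length formula the left side is at most the valuation of n!. This makes the
    subtraction in [weight] exact. *)
Lemma hook_val_le X : hook_val X <= nhooks X.
Proof.
have [la [/and3P[la_s _ /eqP e] la_k XE]] := beta_set_surj X.
have := logn_dimension XE la_s la_k; have := logn2_fact_le (sumn la); rewrite e; lia.
Qed.

Lemma sum_set X : \sum_(x in X) x = nhooks X + \sum_(i < #|X|) i.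
Proof.
have [la [/and3P[la_s _ _] la_k XE]] := beta_set_surj X.
by apply: (sum_beta_set XE).
Qed.

End Hooks.

(** * Core and quotient *)

Lemma double_sum (I : finType) (P : pred I) (F : I -> nat) :
  (\sum_(i | P i) F i).*2 = \sum_(i | P i) (F i).*2.
Proof. by rewrite -mul2n big_distrr; apply: eq_bigr => i _; rewrite /= mul2n. Qed.

Section EvenOdd.
Variable M : nat.

Fact even_ord_subproof (i : 'I_M) : i.*2 < M.*2.
Proof. by rewrite ltn_double. Qed.
Fact odd_ord_subproof (i : 'I_M) : i.*2.+1 < M.*2.
Proof. by rewrite ltn_Sdouble. Qed.
Definition even_ord (i : 'I_M) : 'I_M.*2 := Ordinal (even_ord_subproof i).
Definition odd_ord (i : 'I_M) : 'I_M.*2 := Ordinal (odd_ord_subproof i).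

Lemma even_ord_inj : injective even_ord.
Proof. by move=> i j /(congr1 val) /= /double_inj /val_inj. Qed.
Lemma odd_ord_inj : injective odd_ord.
Proof. by move=> i j /(congr1 val) /= [] /double_inj /val_inj. Qed.
Lemma even_odd_ord (i j : 'I_M) : (even_ord i == odd_ord j) = false.
Proof. by apply/negbTE/eqP => /(congr1 (odd \o val)); rewrite /= !odd_double. Qed.

Lemma big_ord_even_odd (P : pred 'I_M.*2) (F : 'I_M.*2 -> nat) :
  \sum_(x | P x) F x = \sum_(i | P (even_ord i)) F (even_ord i)
                     + \sum_(i | P (odd_ord i)) F (odd_ord i).
Proof.
pose h (u : 'I_M + 'I_M) := match u with inl i => even_ord i | inr i => odd_ord i end.
rewrite (reindex h) /=; first by rewrite big_sumType.
apply: onW_bij; apply: inj_card_bij; last by rewrite card_sum !card_ord addnn.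
move=> [i|i] [j|j] //= => [/even_ord_inj->//|/eqP|/eqP|/odd_ord_inj->//].
  by rewrite even_odd_ord.
by rewrite eq_sym even_odd_ord.
Qed.

Definition evens (X : {set 'I_M.*2}) : {set 'I_M} := [set i | even_ord i \in X].
Definition odds (X : {set 'I_M.*2}) : {set 'I_M} := [set i | odd_ord i \in X].

Lemma card_even_odd (X : {set 'I_M.*2}) : #|X| = #|evens X| + #|odds X|.
Proof.
rewrite -!sum1_card big_ord_even_odd.
by congr (_ + _); apply: eq_bigl => i; rewrite inE.
Qed.

(** A pair of opposite parities has an odd difference, of valuation 0; a pair of equal parity is a
    doubled hook of the quotient, whose valuation grows by 1. Hence the terms [nhooks]. *)
Lemma hook_val_even_odd (X : {set 'I_M.*2}) :
  hook_val X = (hook_val (evens X) + nhooks (evens X))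
             + (hook_val (odds X) + nhooks (odds X)).
Proof.
rewrite /hook_val big_ord_even_odd; congr (_ + _).
  rewrite -big_split /=; apply: eq_big => i; first by rewrite inE.
  rewrite big_ord_even_odd [X in _ + X]big1 ?addn0 => [_|j /andP[_ ji]]; last first.
    by apply: logn2_odd; rewrite oddB 1?ltnW //= !odd_double.
  rewrite -big_split /=; apply: eq_big => j; first by rewrite inE ltn_double.
  rewrite ltn_double => /andP[_ ji].
  by rewrite -doubleB logn2_double ?subn_gt0 // addn1.
rewrite -big_split /=; apply: eq_big => i; first by rewrite inE.
rewrite big_ord_even_odd [X in X + _]big1 ?add0n => [_|j /andP[_ ji]]; last first.
  by apply: logn2_odd; rewrite oddB 1?ltnW //= !odd_double.
rewrite -big_split /=; apply: eq_big => j; first by rewrite inE ltnS ltn_double.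
rewrite ltnS ltn_double => /andP[_ ji].
by rewrite subSS -doubleB logn2_double ?subn_gt0 // addn1.
Qed.

Lemma sum_even_odd (X : {set 'I_M.*2}) :
  \sum_(x in X) x = (\sum_(i in evens X) i).*2 + (\sum_(i in odds X) i).*2 + #|odds X|.
Proof.
rewrite big_ord_even_odd -addnA !double_sum; congr (_ + _).
  by apply: eq_bigl => i; rewrite inE.
rewrite -sum1_card -big_split /=.
by apply: eq_big => i; rewrite ?inE // => _; rewrite addn1.
Qed.

(* The size of the 2-core of a partition whose beta-set has [a] even elements
   and [K.*2 - a] odd ones. *)
Definition core_size (K a : nat) : nat :=
  if K <= a then (a - K) * ((a - K).*2 - 1) else (K - a) * (K - a).*2.+1.

Lemma sum_ord_double (k : nat) : (\sum_(i < k) i).*2 + k = k * k.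
Proof.
elim: k => [|k IHk]; first by rewrite big_ord0.
by rewrite big_ord_recr mulSn mulnS -IHk /=; set S := bigop _ _ _; lia.
Qed.

(** The sum of the elements of [X] is computed by [sum_set] and by [sum_even_odd]; apart from the
    [nhooks], only the numbers of even and odd elements enter. *)
Lemma nhooks_even_odd (X : {set 'I_M.*2}) (K : nat) : #|X| = K.*2 ->
  nhooks X = (nhooks (evens X) + nhooks (odds X)).*2 + core_size K #|evens X|.
Proof.
move=> XK; have := sum_even_odd X; rewrite !sum_set XK.
have := card_even_odd X; rewrite XK.
move: (sum_ord_double K.*2) (sum_ord_double #|evens X|) (sum_ord_double #|odds X|).
set t := \sum_(i < K.*2) _; set ta := \sum_(i < #|evens X|) _; set tb := \sum_(i < #|odds X|) _.
move: (nhooks X) (nhooks _) (nhooks _) #|evens X| #|odds X| t ta tb => n na nb a b t ta tb.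
rewrite {XK}/core_size => ht ha hb ab e; case: leqP => Ka.
  have [d da] : exists d, a = K + d by exists (a - K); lia.
  have Kb : K = b + d by lia.
  subst a; subst K; have -> : b + d + d - (b + d) = d by lia.
  by case: d ht ha hb ab e Ka => [|d]; rewrite ?doubleS; nia.
have [d da] : exists d, K = a + d by exists (K - a); lia.
have Kb : b = a + d + d by lia.
subst b; subst K; have -> : a + d - a = d by lia.
by nia.
Qed.

Definition join_even_odd (A B : {set 'I_M}) : {set 'I_M.*2} :=
  even_ord @: A :|: odd_ord @: B.

Lemma evens_join (A B : {set 'I_M}) : evens (join_even_odd A B) = A.
Proof.
apply/setP => i; rewrite !inE mem_imset; last exact: even_ord_inj.
by case: imsetP => [[j _ /eqP]|]; rewrite ?even_odd_ord ?orbF.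
Qed.

Lemma odds_join (A B : {set 'I_M}) : odds (join_even_odd A B) = B.
Proof.
apply/setP => i; rewrite !inE mem_imset; last exact: odd_ord_inj.
by case: imsetP => [[j _ /eqP]|]; rewrite 1?eq_sym ?even_odd_ord.
Qed.

Lemma join_even_odd_bij : bijective (fun p => join_even_odd p.1 p.2).
Proof.
apply: inj_card_bij => [[A B] [A' B'] /= e|].
  by rewrite -(evens_join A B) -[in X in (_, X)](odds_join A B) e evens_join odds_join.
have cardE (T : finType) : #|{set T}| = 2 ^ #|T|.
  by have := card_powerset [set: T]; rewrite powersetT !cardsT.
by rewrite card_prod !cardE !card_ord -expnD addnn.
Qed.

End EvenOdd.

Definition weight (L : nat) (X : {set 'I_L}) : nat := nhooks X - hook_val X.

Lemma weight_even_odd (M K : nat) (X : {set 'I_M.*2}) : #|X| = K.*2 ->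
  weight X = weight (evens X) + weight (odds X) + core_size K #|evens X|.
Proof.
move=> /nhooks_even_odd; rewrite /weight hook_val_even_odd.
by have := hook_val_le (evens X); have := hook_val_le (odds X); lia.
Qed.

Lemma weight_beta_set (L k : nat) (X : {set 'I_L}) (la : seq nat) :
  vals X = beta_seq k la -> sorted geq la -> size la <= k ->
  weight X = logn 2 (dimension la) + bitsum (sumn la).
Proof.
move=> XE la_s la_k; rewrite /weight /bitsum (nhooks_beta_set XE la_s la_k).
have := logn_dimension XE la_s la_k; have := logn2_fact_le (sumn la); lia.
Qed.

(** * Bijection between partitions and beta-sets of fixed cardinality *)

Lemma partition_nth_inj (la la' : seq nat) :
  all (leq 1) la -> all (leq 1) la' -> nth 0 la =1 nth 0 la' -> la = la'.
Proof.
move=> /allP pos /allP pos' e.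
have sz : size la = size la'.
  case: (ltngtP (size la) (size la')) => // h; have := e (minn (size la) (size la')).
    rewrite (minn_idPl (ltnW h)) nth_default // => e0.
    by have := pos' _ (mem_nth 0 h); rewrite -e0.
  rewrite (minn_idPr (ltnW h)) [RHS]nth_default // => e0.
  by have := pos _ (mem_nth 0 h); rewrite e0.
by apply: (@eq_from_nth _ 0).
Qed.

Lemma size_partition (n : nat) (la : seq nat) : is_partition n la -> size la <= n.
Proof.
case/and3P=> _ pos /eqP <-; elim: la pos => //= x la IHla /andP[x1 /IHla h].
by rewrite -add1n leq_add.
Qed.

Lemma nth_le_sumn (la : seq nat) (r : nat) : nth 0 la r <= sumn la.
Proof.
elim: la r => [|x la IHla] [|r] //=; first exact: leq_addr.
exact: leq_trans (IHla r) (leq_addl _ _).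
Qed.

Section BetaBijection.
Variables (k L n : nat).
Hypotheses (nk : n <= k) (nkL : n + k <= L).

(** [n <= k] leaves room for all the parts, and [n + k <= L] for the largest beta-number, which is
    at most [n + k - 1]. *)
Definition beta_set (la : seq nat) : {set 'I_L} :=
  [set x | val x \in beta_seq k la].

Lemma vals_beta_set (la : seq nat) : is_partition n la ->
  vals (beta_set la) = beta_seq k la.
Proof.
move=> /and3P[la_s _ /eqP la_n].
apply: (irr_sorted_eq ltn_trans ltnn (vals_sorted _) (beta_seq_sorted _ la_s)).
move=> x; apply/mapP/idP => [[y]|hx].
  by rewrite mem_enum inE => yb ->.
have xL : x < L.
  case/mapP: hx => i; rewrite mem_iota /= => ik ->.
  by have := nth_le_sumn la (k - i.+1); rewrite la_n; lia.
by exists (Ordinal xL); rewrite ?mem_enum ?inE.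
Qed.

Lemma beta_set_inj (la la' : seq nat) : is_partition n la -> is_partition n la' ->
  beta_set la = beta_set la' -> la = la'.
Proof.
move=> hla hla' /(congr1 (@vals L)); rewrite !vals_beta_set // => e.
have [/and3P[_ pos _] /and3P[_ pos' _]] := (hla, hla').
apply: partition_nth_inj => // r; case: (ltnP r k) => hr.
  have := congr1 (nth 0 ^~ (k - r.+1)) e; rewrite !nth_mkseq; try lia.
  have -> : k - (k - r.+1).+1 = r by lia.
  by move=> /addIn.
have [hs hs'] := (size_partition hla, size_partition hla').
by rewrite !nth_default //; lia.
Qed.

Lemma beta_set_image :
  (fun p : {bseq n of 'I_n.+1} => beta_set (map val p)) @: partitions n
  = [set X : {set 'I_L} | (#|X| == k) && (nhooks X == n)].
Proof.
apply/setP => X; rewrite inE; apply/imsetP/andP => [[p]|[/eqP Xk /eqP Xn]].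
  rewrite inE => hp ->; have XE := vals_beta_set hp.
  have hs := size_partition hp; have /and3P[la_s _ /eqP la_n] := hp.
  rewrite (card_beta_set XE) (nhooks_beta_set XE) // ?la_n ?eqxx //.
  exact: leq_trans hs nk.
have [la [hla _ XE]] := beta_set_surj X; rewrite Xn Xk in hla XE.
have /partitionsP[p hp e] := hla; exists p => //.
by apply: vals_inj; rewrite -e vals_beta_set.
Qed.

End BetaBijection.

Local Open Scope ring_scope.

(** * Generating functions *)

Section Congruence.
Variables (A : comNzRingType) (N : nat).

(** Congruence modulo the [N]-th power of the variable, so that polynomials can stand for power
    series. *)
Definition eq_below (p q : {poly A}) : Prop := forall n, (n < N)%N -> p`_n = q`_n.

Lemma eq_below_trans (p q r : {poly A}) :
  eq_below p q -> eq_below q r -> eq_below p r.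
Proof. by move=> pq qr n nN; rewrite pq ?qr. Qed.

Lemma eq_belowM (p p' q q' : {poly A}) :
  eq_below p p' -> eq_below q q' -> eq_below (p * q) (p' * q').
Proof.
move=> pp' qq' n nN; rewrite !coefM; apply: eq_bigr => i _.
by rewrite pp' ?qq' //; have := ltn_ord i; lia.
Qed.

Lemma eq_belowX (p q : {poly A}) (k : nat) :
  eq_below p q -> eq_below (p ^+ k) (q ^+ k).
Proof.
by move=> pq; elim: k => [|k IHk] //; rewrite !exprS; apply: eq_belowM.
Qed.

Lemma eq_below_sum (I : finType) (P : pred I) (F F' : I -> {poly A}) :
  (forall i, P i -> eq_below (F i) (F' i)) ->
  eq_below (\sum_(i | P i) F i) (\sum_(i | P i) F' i).
Proof.
by move=> FF' n nN; rewrite !coef_sum; apply: eq_bigr => i /FF' ->.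
Qed.

Lemma eq_below_comp_sqr (p q : {poly A}) :
  eq_below p q -> eq_below (p \Po 'X^2) (q \Po 'X^2).
Proof.
move=> pq n nN; rewrite !coef_comp_poly_Xn //; case: ifP => // _; apply: pq.
exact: leq_ltn_trans (leq_div _ _) nN.
Qed.

Lemma eq_below_monomial (c : A) (d : nat) (p q : {poly A}) :
  (N <= d)%N -> eq_below (c *: 'X^d * p) (c *: 'X^d * q).
Proof.
move=> Nd n nN; rewrite -!scalerAl !coefZ !coefXnM.
by rewrite (leq_trans nN Nd).
Qed.

End Congruence.

Notation bipoly := {poly {poly rat}}.

(* The polynomial [p(XY)] in [Q[Y][X]]. *)
Definition diag_poly (p : {poly rat}) : bipoly := p^:P \Po ('X *: 'X).

Lemma diag_polyXn (p : {poly rat}) (k : nat) : diag_poly (p ^+ k) = diag_poly p ^+ k.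
Proof. by rewrite /diag_poly !rmorphXn. Qed.

Lemma coef_diag_poly (p : {poly rat}) (t : nat) : (diag_poly p)`_t = p`_t *: 'X^t.
Proof.
rewrite /diag_poly coef_comp_poly size_map_polyC.
under eq_bigr => i _ do rewrite coef_map exprZn coefZ coefXn /=.
case: (ltnP t (size p)) => ht.
  rewrite (bigD1 (Ordinal ht)) //= eqxx mulr1 big1 ?addr0 ?mul_polyC // => i it.
  by rewrite (_ : (t == i) = false) ?mulr0 //; apply/negbTE; rewrite eq_sym.
rewrite nth_default // scale0r big1 // => i _.
by rewrite (_ : (t == i) = false) ?mulr0 //; apply/negbTE; have := ltn_ord i; lia.
Qed.

Definition set_gf (k L : nat) : bipoly :=
  \sum_(X : {set 'I_L} | #|X| == k) 'X^(weight X) *: 'X^(nhooks X).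

Definition partition_weight_gf (n : nat) : {poly rat} :=
  \sum_(p in partitions n) 'X^(logn 2 (dimension (map val p)) + bitsum n).

Definition partition_gf (N : nat) : bipoly := \poly_(n < N) partition_weight_gf n.

(** Once [k] and [L] accommodate all the partitions of [n], the coefficient no longer depends on
    them. *)
Lemma coef_set_gf (k L n : nat) : (n <= k)%N -> (n + k <= L)%N ->
  (set_gf k L)`_n = partition_weight_gf n.
Proof.
move=> nk nkL; rewrite coef_sum.
rewrite (eq_bigr (fun X : {set 'I_L} => if nhooks X == n then 'X^(weight X) else 0)); last first.
  by move=> X _; rewrite coefZ coefXn eq_sym; case: eqP; rewrite ?mulr1 ?mulr0.
rewrite -big_mkcondr (eq_bigl (fun Y => Y \in
  [set X : {set 'I_L} | (#|X| == k) && (nhooks X == n)])); last first.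
  by move=> X; rewrite inE.
rewrite -(beta_set_image nk nkL) big_imset /=; last first.
  move=> p q; rewrite !inE => hp hq /(beta_set_inj nk nkL hp hq) e.
  by apply/val_inj/(inj_map val_inj).
apply: eq_bigr => p; rewrite inE => hp; congr ('X^_).
have /and3P[la_s _ /eqP la_n] := hp.
have XE := vals_beta_set nk nkL hp.
rewrite (weight_beta_set XE) ?la_n //.
exact: leq_trans (size_partition hp) nk.
Qed.

(** [a] is the number of even elements. The core has its size as weight, whence the powers of XY;
    the quotient counts twice in the size but once in the weight, whence the substitution in X
    alone. *)
Lemma set_gf_even_odd (K M : nat) :
  set_gf K.*2 M.*2 = \sum_(a < K.*2.+1)
    ('X *: 'X) ^+ core_size K a
    * ((set_gf a M \Po 'X^2) * (set_gf (K.*2 - a) M \Po 'X^2)).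
Proof.
rewrite /set_gf (reindex _ (onW_bij _ (@join_even_odd_bij M))) /=.
rewrite (partition_big (fun p : {set 'I_M} * {set 'I_M} => inord #|p.1| : 'I_K.*2.+1) xpredT) //=.
apply: eq_bigr => a _.
have aK : (a <= K.*2)%N by rewrite -ltnS.
rewrite !raddf_sum /= mulr_suml mulr_sumr; under [RHS]eq_bigr => A _ do rewrite mulr_sumr mulr_sumr.
rewrite pair_big_dep /=; apply: eq_big => [[A B]|[A B] /=].
  rewrite card_even_odd evens_join odds_join /=; apply/andP/andP.
    move=> [/eqP e /eqP/(congr1 val) /=]; rewrite inordK; last by lia.
    by move=> eA; split; apply/eqP; lia.
  move=> [/eqP eA /eqP eB]; rewrite eA eB subnKC //; split=> //.
  by rewrite inord_val.
move=> /andP[/eqP e /eqP/(congr1 val) /=].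
rewrite inordK; last by rewrite ltnS -e card_even_odd evens_join leq_addr.
move=> eA; have := nhooks_even_odd e; have := weight_even_odd e.
rewrite evens_join odds_join eA => -> ->.
rewrite !comp_polyZ !comp_Xn_poly -!exprM exprZn -!scalerAl -!scalerAr !scalerA.
rewrite -!exprD; congr ('X^_ *: 'X^_); lia.
Qed.

(** A finite part of theta: 2-cores are staircases, so the exponents are triangular numbers, namely
    0, 1, 3, 6, ... for [a] equal to K, K+1, K-1, K+2, ... *)
Definition core_gf (K : nat) : {poly rat} := \sum_(a < K.*2.+1) 'X^(core_size K a).

Lemma diag_core_gf (K : nat) :
  diag_poly (core_gf K) = \sum_(a < K.*2.+1) ('X *: 'X) ^+ core_size K a.
Proof.
rewrite /diag_poly /core_gf !raddf_sum /=; apply: eq_bigr => a _.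
by rewrite map_polyXn comp_Xn_poly.
Qed.

Lemma partition_gf_rec (N : nat) :
  eq_below N (partition_gf N)
    (diag_poly (core_gf N.*2) * (partition_gf N \Po 'X^2) ^+ 2).
Proof.
(* With [K = 2N], a core of size below [N] forces [a] to lie between [N] and [3N], and likewise
   [4N - a]; both factors of the quotient are then in the stable range of [coef_set_gf]. *)
set K := N.*2.
apply: (@eq_below_trans _ _ _ (set_gf K.*2 K.*2.*2)).
  by move=> n nN; rewrite coef_poly nN coef_set_gf //; lia.
rewrite set_gf_even_odd diag_core_gf mulr_suml.
apply: eq_below_sum => a _; have aK := ltn_ord a.
have [big|small] := leqP N (core_size K a); first by rewrite exprZn; apply: eq_below_monomial.
have [h1 h2] : (N <= a /\ a <= K + N)%N.
  move: small; rewrite /core_size; case: (leqP K a) => Ka small.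
    suff : (a - K <= N)%N by lia.
    have [->//|d0] := posnP (a - K)%N.
    have h : (0 < (a - K).*2 - 1)%N by lia.
    exact: leq_trans (leq_pmulr (a - K) h) (ltnW small).
  suff : (K - a < N)%N by lia.
  exact: leq_ltn_trans (leq_pmulr (K - a) (ltn0Sn _)) small.
have stable b : (N <= b -> b <= K + N -> eq_below N (set_gf b K.*2) (partition_gf N))%N.
  by move=> b1 b2 n nN; rewrite coef_poly nN coef_set_gf //; lia.
apply: eq_belowM => //; rewrite expr2; apply: eq_belowM; apply: eq_below_comp_sqr;
  apply: stable; lia.
Qed.

Lemma coef_core_gf (K : nat) : (0 < K)%N ->
  [/\ (core_gf K)`_0 = 1, (core_gf K)`_1 = 1, (core_gf K)`_2 = 0
    & (core_gf K)`_3 = 1].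
Proof.
move=> K0.
have coefE t : (core_gf K)`_t = \sum_(a < K.*2.+1) (t == core_size K a)%:R.
  by rewrite coef_sum; apply: eq_bigr => a _; rewrite coefXn.
have single t a0 (h : (a0 < K.*2.+1)%N) :
    (forall a, (t == core_size K a) = (a == a0)) -> (core_gf K)`_t = 1.
  move=> H; rewrite coefE (bigD1 (Ordinal h)) //= H eqxx big1 ?addr0 // => a.
  by rewrite -val_eqE /= H => /negPf ->.
split.
- apply: (single 0%N K) => [|a]; first by lia.
  by rewrite /core_size; case: leqP => h; apply/eqP/eqP; nia.
- apply: (single 1%N K.+1) => [|a]; first by lia.
  by rewrite /core_size; case: leqP => h; apply/eqP/eqP; nia.
- rewrite coefE big1 // => a _; rewrite (_ : (2 == _)%N = false) //.
  by rewrite /core_size; case: leqP => h; apply/eqP; nia.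
- apply: (single 3%N K.-1) => [|a]; first by lia.
  by rewrite /core_size; case: leqP => h; apply/eqP/eqP; nia.
Qed.

(** * Recursion on coefficients *)

Section Recursion.
Variables (N : nat) (G : bipoly) (th : {poly rat}).
Hypothesis G_rec : eq_below N G (diag_poly th * (G \Po 'X^2) ^+ 2).
Hypothesis G_low : forall n w, (w < bitsum n)%N -> G`_n`_w = 0.
Hypothesis G0 : G`_0 = 1.
Hypotheses (th0 : th`_0 = 1) (th1 : th`_1 = 1) (th2 : th`_2 = 0) (th3 : th`_3 = 1).

(** Below degree 4, [th] is 1 + X + X^3; in degree 3 one takes X from three factors or X^3 from one.
    The binomials of the theorem originate here. *)
Lemma coef_th_pow (k : nat) :
  [/\ (th ^+ k)`_0 = 1, (th ^+ k)`_1 = k%:R, (th ^+ k)`_2 = 'C(k, 2)%:R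
    & (th ^+ k)`_3 = 'C(k, 3)%:R + k%:R].
Proof.
elim: k => [|k [h0 h1 h2 h3]].
  by rewrite expr0 !coef1 /= !bin0n; split=> //; rewrite addr0.
rewrite exprS !coefM !big_ord_recr !big_ord0 /= th0 th1 th2 th3 h0 h1 h2 h3.
by rewrite !binS bin1 !natrD -natr1; split; ring.
Qed.

Lemma G_pow_low (k n w : nat) : (w < bitsum n)%N -> (G ^+ k)`_n`_w = 0.
Proof.
elim: k n w => [|k IHk] n w hw.
  rewrite expr0 coef1; case: n hw => [|n] hw; first by rewrite bitsum0 in hw.
  by rewrite coef0.
rewrite exprS coefM coef_sum big1 // => i _; rewrite coefM big1 // => j _.
have [h|h] := ltnP j (bitsum i); first by rewrite G_low ?mul0r.
rewrite IHk ?mulr0 //; have := bitsumD i (n - i).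
by rewrite subnKC; [have := ltn_ord j; lia | have := ltn_ord i; lia].
Qed.

Lemma G_pow_coef0 (k : nat) : (G ^+ k)`_0 = 1.
Proof. by elim: k => [|k IHk]; rewrite ?expr0 ?coef1 // exprS coef0M G0 IHk mulr1. Qed.

(** [t] is the total size of [k] cores, paid in both size and weight; the quotients form a power
    with exponent [2k]. *)
Lemma coef_G_pow (k n w : nat) : (n < N)%N ->
  (G ^+ k)`_n`_w = \sum_(t < n.+1) (th ^+ k)`_t *
    (if (t <= w)%N && (2 %| n - t)%N then (G ^+ k.*2)`_((n - t) %/ 2)`_(w - t) else 0).
Proof.
move=> nN; rewrite (eq_belowX k G_rec nN) exprMn -exprM mul2n -diag_polyXn.
rewrite -[(G \Po _) ^+ _]rmorphXn /= coefM coef_sum; apply: eq_bigr => t _.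
rewrite coef_diag_poly coef_comp_poly_Xn // -scalerAl coefZ; congr (_ * _).
rewrite coefXnM ltnNge; case: leqP => //= _; case: ifP => // _.
by rewrite coef0.
Qed.

(** By [G_pow_low] this is the first coefficient in Y that can be nonzero, and [second] is the next
    one. Exponents are powers of 2 because each use of the recursion doubles them. *)
Definition lowest (j n : nat) : rat := (G ^+ (2 ^ j))`_n`_(bitsum n).
Definition second (j n : nat) : rat := (G ^+ (2 ^ j))`_n`_(bitsum n).+1.

Let c (j t : nat) : rat := (th ^+ (2 ^ j))`_t.

Lemma bitsum_sub (q s : nat) : (s <= q)%N -> (bitsum q <= bitsum (q - s) + s)%N.
Proof.
move=> sq; have := bitsumD (q - s) s; rewrite subnK //; have := bitsum_le s; lia.
Qed.

(** Only [t = b] survives: [t = b + 2s] leaves index [q - s] and weight [bitsum q - 2s], below the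
    minimum [bitsum (q - s)] when [s > 0], by [bitsum_sub]. *)
Lemma lowest_double (j q : nat) (b : bool) : (b + q.*2 < N)%N ->
  lowest j (b + q.*2) = c j b * lowest j.+1 q.
Proof.
move=> nN; rewrite /lowest coef_G_pow // bitsum_double -[((2 ^ j).*2)%N]mul2n -expnS.
rewrite -[(q.*2)%N]muln2.
have bn : (b < (b + q * 2).+1)%N by lia.
rewrite (bigD1 (Ordinal bn)) //= leq_addr addKn dvdn_mull // mulnK // addKn.
rewrite big1 ?addr0 // => t; rewrite -val_eqE /= => tb.
case: ifP => [/andP[tw /dvdnP[r hr]]|_]; last by rewrite mulr0.
rewrite hr mulnK // G_pow_low ?mulr0 //.
have tn := ltn_ord t.
have [s ts] : exists s, t = (b + s.*2)%N :> nat.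
  by exists (q - r)%N; move: hr tb tn; lia.
have -> : r = (q - s)%N by lia.
by have := @bitsum_sub q s; lia.
Qed.

(** One more unit of weight also lets [t = b + 2] survive, and only for odd [q]. *)
Lemma second_double (j q : nat) (b : bool) : (b + q.*2 < N)%N ->
  second j (b + q.*2) = c j b * second j.+1 q
    + (if odd q then c j b.+2 * lowest j.+1 q.-1 else 0).
Proof.
move=> nN; rewrite /second /lowest coef_G_pow // bitsum_double -[((2 ^ j).*2)%N]mul2n -expnS.
rewrite -[(q.*2)%N]muln2.
have bn : (b < (b + q * 2).+1)%N by lia.
rewrite (bigD1 (Ordinal bn)) //= -addnS leq_addr addKn dvdn_mull // mulnK // addKn.
congr (_ + _).
have vanish (t : 'I_(b + q * 2).+1) : t != b :> nat -> t != b.+2 :> nat ->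
    c j t * (if (t <= b + (bitsum q).+1)%N && (2 %| b + q * 2 - t)%N
      then (G ^+ (2 ^ j.+1))`_((b + q * 2 - t) %/ 2)`_(b + (bitsum q).+1 - t) else 0) = 0.
  move=> tb tb2.
  case: ifP => [/andP[tw /dvdnP[r hr]]|_]; last by rewrite mulr0.
  rewrite hr mulnK // G_pow_low ?mulr0 //.
  have tn := ltn_ord t.
  have [s ts] : exists s, t = (b + s.*2)%N :> nat.
    by exists (q - r)%N; move: hr tb tn; lia.
  have -> : r = (q - s)%N by lia.
  by have := @bitsum_sub q s; lia.
have [q0|q0] := posnP q.
  rewrite [in RHS]q0 /= big1 // => t; rewrite -val_eqE => tb; apply: vanish => //.
  by have := ltn_ord t; lia.
have bn2 : (b.+2 < (b + q * 2).+1)%N by lia.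
rewrite (bigD1 (Ordinal bn2)) /=; last by rewrite -val_eqE /=; lia.
rewrite big1 ?addr0; last first.
  by move=> t /andP[]; rewrite -!val_eqE; apply: vanish.
have qh := odd_double_half q.
have bs := @bitsum_sub q 1 q0; rewrite addn1 subn1 in bs.
have -> : (b + q * 2 - b.+2 = q.-1 * 2)%N by lia.
have -> : (b + (bitsum q).+1 - b.+2 = (bitsum q).-1)%N by lia.
rewrite dvdn_mull // mulnK // andbT.
(* For odd [q], passing to [q.-1] drops exactly one binary digit 1, so the remaining coefficient is
   a lowest one. For even positive [q] the digit sum does not drop, and the coefficient vanishes. *)
case oq: (odd q) in qh *.
  have bq : bitsum q = (bitsum q.-1).+1.
    rewrite -qh bitsum_double add1n /=.
    by rewrite -[q./2.*2]/(false + q./2.*2)%N bitsum_double.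
  by rewrite bq /=; case: ifP => //; lia.
case: ifP => h; last by rewrite mulr0.
rewrite G_pow_low ?mulr0 //.
rewrite add0n in qh; have h0 : (0 < q./2)%N by lia.
have -> : q.-1 = (true + q./2.-1.*2)%N by lia.
have := @bitsum_sub q./2 1 h0; rewrite subn1.
have := bitsum_double q./2 false; rewrite /= !add0n qh => ->.
by have := bitsum_double q./2.-1 true; rewrite /= => ->; lia.
Qed.

Lemma lowest0 (j : nat) : lowest j 0 = 1.
Proof. by rewrite /lowest G_pow_coef0 bitsum0 coef1. Qed.

Lemma second0 (j : nat) : second j 0 = 0.
Proof. by rewrite /second G_pow_coef0 bitsum0 coef1. Qed.

Lemma c_bit (j : nat) (b : bool) : c j b = if b then 2 ^+ j else 1.
Proof.
have [h0 h1 _ _] := coef_th_pow (2 ^ j); rewrite /c; case: b => //=.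
by rewrite h1 natrX.
Qed.

Lemma lowest1 (j : nat) : (1 < N)%N -> lowest j 1 = 2 ^+ j.
Proof. by move=> N1; rewrite (@lowest_double j 0 true) // c_bit lowest0 mulr1. Qed.

Lemma second1 (j : nat) : (1 < N)%N -> second j 1 = 0.
Proof. by move=> N1; rewrite (@second_double j 0 true) // second0 mulr0 addr0. Qed.

(** Each halving strips the last bit, with the same factor on both sides, and raises [j] by one; the
    top bit is reached at [R + j], where [lowest1] gives its factor. *)
Lemma lowest_top_bit (R j m : nat) : (m < 2 ^ R)%N -> (2 ^ R + m < N)%N ->
  lowest j (2 ^ R + m) = 2 ^+ (R + j) * lowest j m.
Proof.
elim: R j m => [|R IHR] j m hm nN.
  have m0 : m = 0%N by lia.
  by rewrite m0 expn0 addn0 lowest0 mulr1 lowest1 //; lia.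
have mE := odd_double_half m; rewrite expnS in hm nN *.
have nE : (2 * 2 ^ R + m = odd m + (2 ^ R + m./2).*2)%N by lia.
rewrite nE lowest_double -?nE // IHR; try lia.
rewrite -{3}mE lowest_double; last by lia.
by rewrite addSnnS; ring.
Qed.

(** Halving [R] times raises [j] to [R + j] and leaves 2 or 3, according to the second highest bit.
    The new term is then the coefficient of [th ^+ (2 ^ (R + j))] in degree 2 or 3. *)
Lemma second_top_bit (R j m : nat) : (m < 2 ^ R.+1)%N -> (2 ^ R.+1 + m < N)%N ->
  second j (2 ^ R.+1 + m) = 2 ^+ (R.+1 + j) * second j m +
    (if (m < 2 ^ R)%N then 'C(2 ^ (R + j), 2)%:R * lowest j m
     else ('C(2 ^ (R + j), 3)%:R + 2 ^+ (R + j)) * (lowest j m / 2 ^+ (R + j))).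
Proof.
elim: R j m => [|R IHR] j m hm nN.
  have [_ _ h2 h3] := coef_th_pow (2 ^ j).
  have -> : (2 ^ 1 + m = odd m + 1.*2)%N by lia.
  rewrite second_double ?second1 ?lowest0; try lia.
  rewrite mulr0 add0r mulr1 add0n expn0 /c; case: m hm nN => [|[|//]] _ nN /=.
    by rewrite h2 second0 lowest0 mulr0 add0r mulr1.
  (* For 3, the coefficient in degree 3 takes the place of the factor [lowest j 1 = 2 ^+ j], which
     explains the division in the statement. *)
  rewrite h3 second1 ?lowest1; try lia.
  by rewrite mulr0 add0r divff ?mulr1 ?natrX // expf_neq0.
have mE := odd_double_half m; rewrite [(2 ^ R.+2)%N]expnS in hm nN *.
have nE : (2 * 2 ^ R.+1 + m = odd m + (2 ^ R.+1 + m./2).*2)%N by lia.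
rewrite nE second_double -?nE // IHR; try lia.
rewrite -[X in second j X]mE second_double; last by lia.
rewrite -[X in lowest j X]mE lowest_double; last by lia.
have -> : (m < 2 ^ R.+1)%N = (m./2 < 2 ^ R)%N by rewrite expnS; lia.
have -> : odd (2 ^ R.+1 + m./2) = odd m./2 by rewrite oddD oddX.
rewrite !addSnnS.
set C := c j (odd m); set C' := c j _.
(* Taking the predecessor of an odd number leaves its top bit alone, so this correction scales by
   [lowest_top_bit]. *)
have -> : (if odd m./2 then C' * lowest j.+1 (2 ^ R.+1 + m./2).-1 else 0)
        = 2 ^+ (R + j.+2) * (if odd m./2 then C' * lowest j.+1 m./2.-1 else 0).
  case: ifP => o; last by rewrite mulr0.
  have m0 : (0 < m./2)%N by case: (m./2) o.
  have -> : (2 ^ R.+1 + m./2).-1 = (2 ^ R.+1 + m./2.-1)%N by lia.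
  rewrite lowest_top_bit; try lia.
  by rewrite addSnnS; ring.
by case: ifP => _; ring.
Qed.

End Recursion.

(** * From 2-adic valuations to residues modulo 4, and the conclusion *)

(** Positivity excludes the degenerate value [logn 2 0 = 0]. *)
Lemma dimension_gt0 (n : nat) (la : seq nat) : is_partition n la -> (0 < dimension la)%N.
Proof.
move=> hla; have XE := vals_beta_set (leqnn n) (leqnn _) hla.
have /and3P[la_s _ _] := hla.
have := fact_gt0 (sumn la).
by rewrite -(hook_length_formula XE la_s (size_partition hla)) muln_gt0 => /andP[].
Qed.

Lemma logn2_eq0 (d : nat) : (0 < d)%N ->
  (logn 2 d == 0%N) = (d == 1 %[mod 4]) || (d == 3 %[mod 4]).
Proof.
move=> d0; have -> : (logn 2 d == 0%N) = odd d.
  rewrite -{2}(odd_double_half d) oddD odd_double addbF.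
  case o : (odd d); first by rewrite logn2_odd.
  by rewrite -(odd_double_half d) o add0n logn2_double //; lia.
lia.
Qed.

Lemma logn2_eq1 (d : nat) : (0 < d)%N -> (logn 2 d == 1%N) = (d == 2 %[mod 4]).
Proof.
move=> d0; case o : (odd d); first by rewrite logn2_odd //; lia.
have dE : d = (d./2).*2 by lia.
have h0 : (0 < d./2)%N by lia.
rewrite {1}dE logn2_double // eqSS logn2_eq0 //; lia.
Qed.

Lemma coef_partition_weight_gf (n v : nat) :
  (partition_weight_gf n)`_(v + bitsum n)
  = #|[set p in partitions n | logn 2 (dimension (map val p)) == v]|%:R.
Proof.
rewrite coef_sum -sum1dep_card natr_sum big_mkcondr; apply: eq_bigr => p _.
by rewrite coefXn eqn_add2r eq_sym; case: eqP.
Qed.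

Lemma coef_lowest (n : nat) : (partition_weight_gf n)`_(bitsum n) = (a_odd n)%:R.
Proof.
rewrite -[bitsum n]add0n coef_partition_weight_gf /a_odd /a_mod4; congr (_%:R).
rewrite -cardsUI [X in (_ + X)%N]eq_card0 ?addn0; last first.
  by move=> p; rewrite !inE; lia.
apply: eq_card => p; rewrite !inE -andb_orr; case: (boolP (is_partition _ _)) => //= hp.
by rewrite logn2_eq0 // (dimension_gt0 hp).
Qed.

Lemma coef_second (n : nat) : (partition_weight_gf n)`_(bitsum n).+1 = (a_mod4 2 n)%:R.
Proof.
rewrite -add1n coef_partition_weight_gf /a_mod4; congr (_%:R).
apply: eq_card => p; rewrite !inE; case: (boolP (is_partition _ _)) => //= hp.
by rewrite logn2_eq1 // (dimension_gt0 hp).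
Qed.

Lemma partition_gf_low (N n w : nat) : (w < bitsum n)%N -> (partition_gf N)`_n`_w = 0.
Proof.
move=> hw; rewrite coef_poly; case: ifP => _; last by rewrite coef0.
rewrite coef_sum big1 // => p _; rewrite coefXn (_ : (w == _) = false) //.
by apply/negbTE; lia.
Qed.

Lemma partition_gf0 (N : nat) : (0 < N)%N -> (partition_gf N)`_0 = 1.
Proof.
move=> N0; rewrite coef_poly N0 /partition_weight_gf (big_pred1 [bseq]) /=.
  by rewrite dimension_nil logn1 bitsum0.
move=> p; rewrite inE; have -> : p = [bseq] by apply: val_inj; case: p => -[].
by rewrite /= eqxx.
Qed.

Theorem theorem1p1 (n R m : nat)
    (hR : (1 <= R)%N) (hm : (m < 2 ^ R)%N) (hn : n = (2 ^ R + m)%N) :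
  (a_mod4 2 n)%:R =
    (if (m < 2 ^ R.-1)%N then
       2 ^+ R * (a_mod4 2 m)%:R + 'C(2 ^ R.-1, 2)%:R * (a_odd m)%:R
     else
       2 ^+ R * (a_mod4 2 m)%:R
       + ('C(2 ^ R.-1, 3)%:R + 2 ^+ R.-1) * ((a_odd m)%:R / 2 ^+ R.-1))
  :> rat.
Proof.
case: R hR hm hn => // R _ hm hn; rewrite succnK.
pose N := n.+1.
have [|t0 t1 t2 t3] := @coef_core_gf N.*2; first by rewrite /N; lia.
have secondE l : (l < N)%N -> second (partition_gf N) 0 l = (a_mod4 2 l)%:R.
  by move=> lN; rewrite /second expn0 expr1 coef_poly lN coef_second.
have lowestE l : (l < N)%N -> lowest (partition_gf N) 0 l = (a_odd l)%:R.
  by move=> lN; rewrite /lowest expn0 expr1 coef_poly lN coef_lowest.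
(* [j = 0] selects the first power of the generating function, and [N = n.+1] keeps its coefficient
   of index [n]. *)
have := second_top_bit (@partition_gf_rec N) (@partition_gf_low N)
  (partition_gf0 (ltn0Sn n)) t0 t1 t2 t3 0 hm.
rewrite -hn => /(_ (ltnSn n)); rewrite !addn0 !secondE ?lowestE; try by rewrite /N; lia.
by move=> ->; case: ifP.
Qed.
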